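(* Let $n\ge2$, $0<\epsilon<1$, $0<\delta<1$, and let $A$ be any distribution on $\{1,\dots,n\}$. Draw $m$ i.i.d. samples from $A$ and let $\hat A_i=X_i/m$, where $X_i$ is the number of samples equal to $i$. (i) If $1\le p\le2$ with Hölder conjugate $q$ and \[ m=\max\left\{\frac{2^{\frac2p+1}\ln(1/\delta)}{\epsilon^2},\ M\right\},\qquad M=\begin{cases}4\dfrac{n}{(n^{1/q}\epsilon)^2} & n\le\left(\frac4\epsilon\right)^q,\\[1em]\dfrac14\left(\frac4\epsilon\right)^q & n\ge\left(\frac4\epsilon\right)^q,\end{cases}\] then $\|\hat A-A\|_p\le\epsilon$ with probability at least $1-\delta$. In particular for $p=1$ it suffices that $m=\max\{8\ln(1/\delta)/\epsilon^2,\ 4n/\epsilon^2\}$. (ii) If $p\ge2$ (including $p=\infty$) and $m=\max\left\{\frac{4\ln(1/\delta)}{\epsilon^2},\frac4{\epsilon^2}\right\}$, then $\|\hat A-A\|_p\le\epsilon$ with probability at least $1-\delta$.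
   Context: A distribution on $\{1,\dots,n\}$ is a vector $A\in\mathbb{R}^n$, $A_i\ge0$, $\sum_iA_i=1$; $\|V\|_p=(\sum_i|V_i|^p)^{1/p}$, $\|V\|_\infty=\max_i|V_i|$. Hölder conjugate: $q=p/(p-1)$ for $1<p\le2$, $q=\infty$ for $p=1$; when $q=\infty$, $n^{1/q}=1$ and $(4/\epsilon)^q=\infty$. *)

(* Defs.v *)
From HB Require Import structures.
From mathcomp Require Import all_boot all_order all_algebra.
From mathcomp Require Import all_classical all_reals all_analysis.
Import Order.TTheory GRing.Theory Num.Theory.
Import numFieldNormedType.Exports.

Set Implicit Arguments.
Unset Strict Implicit.
Unset Printing Implicit Defensive.

Local Open Scope classical_set_scope.
Local Open Scope ring_scope.

Definition distribution_on (R : realType) (n : nat) (A : 'rV[R]_n) : Prop :=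
  (forall i, 0 <= A 0 i) /\ \sum_i A 0 i = 1.

(* Only meant for 1 <= p <= +oo; the value at -oo is junk. *)
Definition lpnorm (R : realType) (n : nat) (p : \bar R) (V : 'rV[R]_n) : R :=
  match p with
  | r%:E => (\sum_i `|V 0 i| `^ r) `^ r^-1
  | +oo%E => \big[Num.max/0]_i `|V 0 i|
  | -oo%E => 0
  end.

(* S 0, ..., S (m-1) are i.i.d. with law A: 'I_n carries the discrete
   sigma-algebra, and independence is mutual (the product rule holds for
   every subfamily J of the indices). *)
Definition iid_samples (R : realType) (d : measure_display)
    (T : measurableType d) (P : probability T R) (n m : nat)
    (A : 'rV[R]_n) (S : 'I_m -> T -> 'I_n) : Prop :=
  [/\ forall (j : 'I_m) (E : set 'I_n), measurable (S j @^-1` E),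
      forall (j : 'I_m) (i : 'I_n), P (S j @^-1` [set i]) = (A 0 i)%:E
    & forall (J : {set 'I_m}) (E : 'I_m -> set 'I_n),
        P (\bigcap_(j in [set` J]) (S j @^-1` E j)) =
        (\prod_(j in J) P (S j @^-1` E j))%E].

Definition sample_count (T : Type) (n m : nat) (S : 'I_m -> T -> 'I_n)
    (w : T) (i : 'I_n) : nat := #|[set j | S j w == i]%SET|.

Definition empirical (R : realType) (T : Type) (n m : nat)
    (S : 'I_m -> T -> 'I_n) (w : T) : 'rV[R]_n :=
  \row_i ((sample_count S w i)%:R / m%:R).

(* x ^ q for 1 < x and an extended exponent q, with x ^ +oo = +oo. *)
Definition pow_ext (R : realType) (x : R) (q : \bar R) : \bar R :=
  match q with
  | r%:E => (x `^ r)%:E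
  | +oo%E => +oo%E
  | -oo%E => 0%E
  end.

(* n ^ (1/q), which is 1 when q = +oo because inve +oo = 0. *)
Definition root_ext (R : realType) (x : R) (q : \bar R) : R :=
  x `^ fine (q^-1)%E.

(* The two branches agree when n = (4 / eps) ^ q.  When q = +oo the first
   branch is always taken, so [fine] is only applied to finite values. *)
Definition sample_bound_M (R : realType) (n : nat) (eps : R) (q : \bar R) : R :=
  if (n%:R%:E <= pow_ext (4 / eps) q)%E
  then 4 * (n%:R / (root_ext n%:R q * eps) ^+ 2)
  else 1 / 4 * fine (pow_ext (4 / eps) q).

(* Main.v *)
Require Import Defs.
From HB Require Import structures.
From mathcomp Require Import all_boot all_order all_algebra.
From mathcomp Require Import all_classical all_reals all_analysis.
From mathcomp Require Import ring lra.
Import Order.TTheory GRing.Theory Num.Theory.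
Import numFieldNormedType.Exports.

Set Implicit Arguments.
Unset Strict Implicit.
Unset Printing Implicit Defensive.

Local Open Scope classical_set_scope.
Local Open Scope ring_scope.

(* McDiarmid's inequality plus a bound on the mean.  Replacing one sample moves
   the empirical distribution by (e_i - e_j) / m, so by Minkowski the l_p error
   changes by at most c = 2^(1/p) / m, and the error exceeds its mean by eps / 2
   with probability at most exp(- m eps^2 / 2^(2/p + 1)).  For p <= 2 the mean is
   at most eps / 2 as soon as sum_i E|A^_i - A_i|^p <= (eps / 2)^p.  The count X_i
   has variance at most m A_i and mean absolute deviation at most 2 m A_i; the
   variance alone gives the bound (m n)^(-p/2) n on that sum, and interpolating
   between both gives the dimension-free bound 2^(2-p) m^(1-p).  For p >= 2 the
   l_p norm is at most the l_2 norm. *)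

(** * Scalar inequalities from calculus and convexity *)

Lemma is_derive_ge0_le (R : realType) (f df : R -> R) (a b : R) :
  a <= b -> (forall x : R, is_derive x 1 f (df x)) ->
  (forall x, a <= x -> 0 <= df x) -> f a <= f b.
Proof.
move=> ab fdf df0.
have fc : {within `[a, b], continuous f}.
  apply: continuous_subspaceT => y.
  by apply/differentiable_continuous/derivable1_diffP; case: (fdf y).
have [c] := MVT_segment ab (fun x _ => fdf x) fc.
rewrite in_itv/= => /andP[ac _] fE.
by rewrite -subr_ge0 fE mulr_ge0 ?df0 ?subr_ge0.
Qed.

(** Hoeffding's lemma for a Bernoulli variable of mean [t]: the ratio of the left side to the right
    side is 1 at 0 and nonincreasing on x >= 0, because the logarithmic derivative of the left side
    is at most t + x/4. *)
Lemma bernoulli_mgf_le (R : realType) (t h : R) :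
  0 <= t <= 1 -> 0 <= h ->
  (1 - t) + t * expR h <= expR (t * h + h ^+ 2 / 8).
Proof.
move=> /andP[t0 t1] h0.
pose D (x : R) := (1 - t) + t * expR x.
have D0 x : 0 < D x.
  rewrite /D; have e0 := expR_gt0 x.
  have [->|tn1] := eqVneq t 1; first by lra.
  by apply: ltr_wpDr; [rewrite mulr_ge0// ltW|rewrite subr_gt0 lt_neqAle tn1].
have dD (x : R) : is_derive x 1 D (t * expR x).
  rewrite /D; apply: is_derive_eq.
  by rewrite add0r mul1r.
(* the tilted mean [t e^x / D x] is the derivative of the log-mgf [ln D]; it is
   1/4-Lipschitz because its derivative is a Bernoulli variance *)
have tilt x : 0 <= x -> t * expR x / D x <= t + x / 4.
  move=> x0.
  pose u (y : R) := (D y)^-1.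
  have du (y : R) : is_derive y 1 u (- (D y) ^- 2 * (t * expR y)).
    exact: (is_deriveV (lt0r_neq0 (D0 y))).
  pose g (y : R) := t + y / 4 - t * expR y * u y.
  pose dg (y : R) := 4^-1 - t * expR y * (D y)^-1 * (1 - t * expR y * (D y)^-1).
  have dgE (y : R) : is_derive y 1 g (dg y).
    rewrite /g /dg; apply: is_derive_eq.
    rewrite /u /GRing.scale/=; have := lt0r_neq0 (D0 y).
    by move: (D y) (expR y) => d e d0; field.
  have dg0 y : 0 <= y -> 0 <= dg y.
    (* With [v] the tilted mean, this is v (1 - v) <= 1/4. *)
    move=> _; rewrite /dg; move: (t * _ / _) => v.
    by have := sqr_ge0 (v - 2^-1); rewrite expr2; lra.
  have := is_derive_ge0_le x0 dgE dg0.
  have gE : g 0 = 0 by rewrite /g /u /D expR0; field; lra.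
  by rewrite gE /g /u; lra.
(* The sign turns the decreasing ratio into an increasing function, as [is_derive_ge0_le]
   expects. *)
pose k (x : R) := - (D x * expR (- (t * x) - x ^+ 2 / 8)).
pose dk (x : R) := expR (- (t * x) - x ^+ 2 / 8) *
   ((t + x / 4) * D x - t * expR x).
have dkE (x : R) : is_derive x 1 k (dk x).
  rewrite /k /dk; apply: is_derive_eq.
  by rewrite /GRing.scale/=; field.
have := @is_derive_ge0_le R k dk 0 h h0 dkE.
move=> /(_ _)/wrap[x x0|].
  rewrite /dk mulr_ge0 ?expR_ge0// subr_ge0 -ler_pdivrMr//; exact: tilt.
rewrite /k /D mulr0 expr0n/= mul0r subr0 oppr0 !expR0 !mulr1 subrK lerN2.
by rewrite -opprD expRN ler_pdivrMr ?expR_gt0// mul1r.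
Qed.

(** Tangent line at 1 of the concave power function, obtained from convexity of exp between ln x and
    0. It later replaces powers by moments of order 1 and 2 inside expectations. *)
Lemma powR_le_affine (R : realType) (x a : R) :
  0 <= x -> 0 <= a <= 1 -> x `^ a <= (1 - a) + a * x.
Proof.
rewrite le_eqVlt => /predU1P[<-|x0] /andP[a0 a1].
  rewrite mulr0 addr0; have [->|an0] := eqVneq a 0.
    by rewrite powRr0 subr0.
  by rewrite powR0// subr_ge0.
have := convex_expR (Itv01 a0 a1) (ln x) 0.
rewrite !convRE/= expR0 lnK ?posrE// mulr0 addr0 mulr1 addrC /unstable.onem.
by rewrite /powR gt_eqF.
Qed.

(** * Expectation over i.i.d. draws *)

(* The expectation of [F] over [m] i.i.d. draws from [A]; sequences instead of
   tuples make the coordinate-by-coordinate induction immediate. *)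
Fixpoint esp (R : realType) (n : nat) (A : 'rV[R]_n) (m : nat)
    (F : seq 'I_n -> R) : R :=
  if m is k.+1 then \sum_i A 0 i * esp A k (fun l => F (i :: l)) else F [::].

Lemma eq_esp (R : realType) (n : nat) (A : 'rV[R]_n) m F G :
  F =1 G -> esp A m F = esp A m G.
Proof.
elim: m F G => [|m IH] F G FG /=; first exact: FG.
by apply: eq_bigr => i _; congr (_ * _); apply: IH => l; exact: FG.
Qed.

(** The recursion unfolds to a finite sum against the product law; linearity, monotonicity and the
    link with the probability space are read off from this form. *)
Lemma esp_tupleE (R : realType) (n : nat) (A : 'rV[R]_n) m F :
  esp A m F = \sum_(t : m.-tuple 'I_n) (\prod_(j < m) A 0 (tnth t j)) * F t.
Proof.
elim: m F => [|m IH] F.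
  rewrite (big_pred1 [tuple]) => [|t]; last by rewrite [t]tuple0/= eqxx.
  by rewrite big_ord0 mul1r.
rewrite /=.
under eq_bigr do rewrite IH big_distrr/=.
rewrite pair_big/=.
rewrite [RHS](reindex (fun p : 'I_n * m.-tuple 'I_n => [tuple of p.1 :: p.2])).
  apply: eq_bigr => -[i t] _ /=.
  rewrite big_ord_recl/= tnth0 -mulrA; congr (_ * (_ * _)).
  by apply: eq_bigr => j _; rewrite tnthS.
exists (fun t => (thead t, [tuple of behead t])) => [[i t] _|t _] /=.
  by congr pair; apply: val_inj.
by rewrite [in RHS](tuple_eta t).
Qed.

Lemma espD (R : realType) (n : nat) (A : 'rV[R]_n) m F G :
  esp A m (fun l => F l + G l) = esp A m F + esp A m G.
Proof.
by rewrite !esp_tupleE -big_split; apply: eq_bigr => t _; rewrite mulrDr.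
Qed.

Lemma espZ (R : realType) (n : nat) (A : 'rV[R]_n) m a F :
  esp A m (fun l => a * F l) = a * esp A m F.
Proof.
by rewrite !esp_tupleE big_distrr; apply: eq_bigr => t _; rewrite mulrCA.
Qed.

Lemma esp_sum (R : realType) (n : nat) (A : 'rV[R]_n) m (I : finType)
    (F : I -> seq 'I_n -> R) :
  esp A m (fun l => \sum_i F i l) = \sum_i esp A m (F i).
Proof.
rewrite esp_tupleE; under eq_bigr do rewrite big_distrr/=.
by rewrite exchange_big/=; apply: eq_bigr => i _; rewrite esp_tupleE.
Qed.

Lemma esp_cst (R : realType) (n : nat) (A : 'rV[R]_n) m a :
  distribution_on A -> esp A m (fun=> a) = a.
Proof.
by case=> _ A1; elim: m => //= m ->; rewrite -big_distrl/= A1 mul1r.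
Qed.

Lemma le_esp (R : realType) (n : nat) (A : 'rV[R]_n) m F G :
  distribution_on A -> (forall l, F l <= G l) -> esp A m F <= esp A m G.
Proof.
case=> A0 _ FG; rewrite !esp_tupleE; apply: ler_sum => t _.
by rewrite ler_wpM2l// prodr_ge0.
Qed.

(** * Hoeffding's lemma and McDiarmid's inequality *)

(** The values of [g] lie in an interval [a, a + c]. Bounding exp by its chord there reduces the
    claim to a Bernoulli variable whose mean [t] is the rescaled mean of [g]. *)
Lemma hoeffding_lemma (R : realType) (n : nat) (A : 'rV[R]_n)
    (g : 'I_n -> R) (c s : R) :
  distribution_on A -> 0 <= s -> (forall i j, g i - g j <= c) ->
  \sum_i A 0 i * expR (s * g i) <=
  expR (s * \sum_i A 0 i * g i + s ^+ 2 * c ^+ 2 / 8).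
Proof.
move=> [A0 A1] s0 gc.
have [k _ kmin] : exists2 k : 'I_n, true & forall i, g k <= g i.
  case: n A g A0 A1 gc => [|n] A g A0 A1 gc.
    by move: A1; rewrite big_ord0 => /eqP; rewrite eq_sym oner_eq0.
  have [k _ kP] := @arg_minP _ _ _ ord0 xpredT g isT.
  by exists k => // i; exact: kP.
have c0 : 0 <= c by have := gc k k; rewrite subrr.
pose a := g k; pose t := \sum_i A 0 i * ((g i - a) / c).
(* Rescaling divides by [c], so constant [g] is treated apart. *)
have [cz|cn0] := eqVneq c 0.
  have gE i : g i = a.
    by apply/eqP; rewrite eq_le kmin andbT -subr_le0 -cz gc.
  under eq_bigr do rewrite gE.
  under [X in _ <= expR (s * X + _)]eq_bigr do rewrite gE.
  by rewrite -!big_distrl/= A1 !mul1r cz expr0n/= mulr0 mul0r addr0.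
have cp : 0 < c by rewrite lt_neqAle eq_sym cn0.
have t01 i : 0 <= (g i - a) / c <= 1.
  by rewrite divr_ge0 ?subr_ge0 ?kmin//= ler_pdivrMr// mul1r gc.
have tb : 0 <= t <= 1.
  apply/andP; split.
    by apply: sumr_ge0 => i _; rewrite mulr_ge0//; case/andP: (t01 i).
  rewrite -A1; apply: ler_sum => i _.
  by rewrite -[leRHS]mulr1 ler_wpM2l//; case/andP: (t01 i).
have meanE : \sum_i A 0 i * g i = a + t * c.
  rewrite /t big_distrl/= -[X in X + _]mul1r -A1 big_distrl/= -big_split/=.
  by apply: eq_bigr => i _; field.
have chord i : expR (s * g i) <= expR (s * a) *
    (1 - (g i - a) / c + (g i - a) / c * expR (s * c)).
  have /andP[r0 r1] := t01 i.
  have := convex_expR (Itv01 r0 r1) (s * c) 0.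
  rewrite !convRE/= expR0 /unstable.onem mulr0 addr0 mulr1 => H.
  rewrite [s * g i](_ : _ = s * a + (g i - a) / c * (s * c)); last by field.
  by rewrite expRD ler_wpM2l ?expR_ge0// [leRHS]addrC.
apply: (@le_trans _ _ (expR (s * a) * (1 - t + t * expR (s * c)))).
  apply: (@le_trans _ _ (\sum_i A 0 i * (expR (s * a) *
    (1 - (g i - a) / c + (g i - a) / c * expR (s * c))))).
    by apply: ler_sum => i _; rewrite ler_wpM2l.
  rewrite le_eqVlt; apply/predU1P; left.
  rewrite -[X in X - t + _]A1 /t -sumrB big_distrl/= -big_split/= big_distrr/=.
  by apply: eq_bigr => i _; ring.
apply: (le_trans (ler_wpM2l (expR_ge0 _) (bernoulli_mgf_le tb _))).
  by rewrite mulr_ge0.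
by rewrite -expRD ler_expR meanE le_eqVlt; apply/predU1P; left; field.
Qed.

(** Allowing every position and every length lets the property pass from [f] to [f (i :: _)]; since
    [i] and [j] can be swapped, the one-sided bound is two-sided. *)
Definition bounded_differences (R : realType) (n : nat) (c : R)
    (f : seq 'I_n -> R) : Prop :=
  forall l1 l2 i j, f (l1 ++ i :: l2) - f (l1 ++ j :: l2) <= c.

(** Induction on the draws: given the first draw, the others contribute m terms to the exponent, and
    Hoeffding's lemma applied to the conditional mean as a function of the first draw contributes
    one more. *)
Lemma mcdiarmid_mgf (R : realType) (n : nat) (A : 'rV[R]_n) (m : nat)
    (f : seq 'I_n -> R) (c s : R) :
  distribution_on A -> 0 <= s -> bounded_differences c f ->
  esp A m (fun l => expR (s * f l)) <=
  expR (s * esp A m f + m%:R * (s ^+ 2 * c ^+ 2 / 8)).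
Proof.
move=> dA s0; elim: m f => [|m IH] f fc /=; first by rewrite mul0r addr0.
set v := s ^+ 2 * c ^+ 2 / 8.
apply: (@le_trans _ _ (\sum_i A 0 i *
    expR (s * esp A m (fun l => f (i :: l)) + m%:R * v))).
  apply: ler_sum => i _; rewrite ler_wpM2l ?(proj1 dA)//; apply: IH => l1 l2.
  exact: fc (i :: l1) l2.
under [leLHS]eq_bigr do rewrite expRD mulrA.
rewrite -big_distrl/= -natr1 mulrDl mul1r addrA addrAC [leRHS]expRD.
rewrite ler_wpM2r ?expR_ge0//; apply: hoeffding_lemma => // i j.
(* Two conditional means differ by the expectation of a difference that is pointwise at most [c]. *)
rewrite -mulN1r -espZ -espD -[c](esp_cst m c dA); apply: le_esp => // l.
by rewrite mulN1r; exact: fc [::] l i j.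
Qed.

(** Chernoff's method with [s] left free: the indicator of f <= eps is at least 1 - exp(s (f -
    eps)). *)
Lemma mcdiarmid (R : realType) (n : nat) (A : 'rV[R]_n) (m : nat)
    (f : seq 'I_n -> R) (c s eps : R) :
  distribution_on A -> 0 <= s -> bounded_differences c f ->
  1 - expR (s * (esp A m f - eps) + m%:R * (s ^+ 2 * c ^+ 2 / 8)) <=
  esp A m (fun l => (f l <= eps)%R%:R).
Proof.
move=> dA s0 fc.
apply: (@le_trans _ _ (1 - expR (- (s * eps)) * esp A m (fun l => expR (s * f l)))).
  rewrite lerB// mulrBr addrAC [X in _ <= expR X]addrC expRD.
  rewrite ler_wpM2l ?expR_ge0//; exact: mcdiarmid_mgf.
rewrite -[X in X - _](esp_cst m 1 dA) -mulNr -espZ -espD; apply: le_esp => // l.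
rewrite mulNr -expRD /=; have [_|fe] := leP (f l) eps.
  by rewrite mulr1n gerBl expR_ge0.
by rewrite subr_le0 -expR0 ler_expR addrC -mulrBr mulr_ge0// subr_ge0 ltW.
Qed.

(** * Norm inequalities *)

Lemma lpnorm_ge0 (R : realType) (n : nat) (p : \bar R) (v : 'rV[R]_n) :
  0 <= lpnorm p v.
Proof.
case: p => [p||]//=; first exact: powR_ge0.
by elim/big_ind: _ => // x y x0 y0; rewrite le_max x0.
Qed.

Lemma powR_lpnorm (R : realType) (n : nat) (p : R) (v : 'rV[R]_n) :
  0 < p -> lpnorm p%:E v `^ p = \sum_i `|v 0 i| `^ p.
Proof.
move=> p0; rewrite -powRrM mulVf ?gt_eqF// powRr1//.
by apply: sumr_ge0 => i _; exact: powR_ge0.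
Qed.

Lemma lpnorm_le (R : realType) (n : nat) (p b : R) (v : 'rV[R]_n) :
  0 < p -> 0 <= b -> \sum_i `|v 0 i| `^ p <= b `^ p -> lpnorm p%:E v <= b.
Proof.
move=> p0 b0 vb.
rewrite -[leRHS]powRr1// -(mulfV (lt0r_neq0 p0)) powRrM/=.
rewrite ge0_ler_powR ?nnegrE ?powR_ge0 ?invr_ge0 ?(ltW p0)//.
by apply: sumr_ge0 => i _; exact: powR_ge0.
Qed.

Lemma lpnorm_eq0 (R : realType) (n : nat) (p : R) (v : 'rV[R]_n) :
  0 < p -> lpnorm p%:E v = 0 -> v = 0.
Proof.
move=> p0 v0; have := powR_lpnorm v p0.
rewrite v0 powR0 ?gt_eqF// => /esym/eqP.
rewrite psumr_eq0 => [|i _]; last exact: powR_ge0.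
move=> /allP vi; apply/rowP => i; rewrite mxE.
have := vi i (mem_index_enum i); rewrite implyTb => /eqP/powR_eq0_eq0/eqP.
by rewrite normr_eq0 => /eqP.
Qed.

(** Minkowski from convexity of x^p: with a and b the two norms, both nonzero, |u_i + v_i| / (a + b)
    is at most the mean of |u_i| / a and |v_i| / b with weights a/(a+b) and b/(a+b), and the
    normalised p-th powers sum to 1. *)
Lemma lpnorm_triangle (R : realType) (n : nat) (p : R) (u v : 'rV[R]_n) :
  1 <= p -> lpnorm p%:E (u + v) <= lpnorm p%:E u + lpnorm p%:E v.
Proof.
move=> p1; have p0 : 0 < p by rewrite (lt_le_trans ltr01).
have := lpnorm_ge0 p%:E u.
rewrite le_eqVlt => /predU1P[/esym/(lpnorm_eq0 p0) ->|a0].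
  by rewrite add0r lerDr lpnorm_ge0.
have := lpnorm_ge0 p%:E v.
rewrite le_eqVlt => /predU1P[/esym/(lpnorm_eq0 p0) ->|b0].
  by rewrite addr0 lerDl lpnorm_ge0.
have uE := powR_lpnorm u p0; have vE := powR_lpnorm v p0.
apply: lpnorm_le => //; first by rewrite addr_ge0 ?lpnorm_ge0.
move: (lpnorm _ u) (lpnorm _ v) a0 b0 uE vE => a b a0 b0 uE vE.
have s0 : 0 < a + b by rewrite addr_gt0.
have t01 : 0 <= a / (a + b) <= 1.
  by rewrite divr_ge0 ?(ltW a0, ltW s0)//= ler_pdivrMr// mul1r lerDl ltW.
have /andP[t0 t1] := t01.
have tE : 1 - a / (a + b) = b / (a + b) by field; lra.
have cvx (x y : R) : 0 <= x -> 0 <= y -> (a / (a + b) * x + b / (a + b) * y) `^ p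
    <= a / (a + b) * x `^ p + b / (a + b) * y `^ p.
  move=> x0 y0; have := @convex_powR R p p1 (Itv01 t0 t1) x y.
  rewrite !inE/= !in_itv/= !andbT => /(_ x0 y0).
  by rewrite [X in X `^ _]convRE convRE/= /unstable.onem tE.
apply: (@le_trans _ _ (\sum_i (a + b) `^ p *
    (a / (a + b) * (`|u 0 i| `^ p / a `^ p) +
     b / (a + b) * (`|v 0 i| `^ p / b `^ p)))).
  apply: ler_sum => i _; rewrite mxE.
  have := cvx (`|u 0 i| / a) (`|v 0 i| / b).
  rewrite !mulr_ge0 ?invr_ge0 ?(ltW a0, ltW b0)// => /(_ isT isT) H.
  have divE (x y : R) : 0 <= x -> 0 < y -> (x / y) `^ p = x `^ p / y `^ p.
    move=> x0 y0; rewrite powRM ?invr_ge0 ?(ltW y0)// -powR_inv1 ?(ltW y0)//.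
    by rewrite -powRrM mulN1r powRN.
  rewrite -!divE//; apply: le_trans (ler_wpM2l (powR_ge0 _ _) H).
  rewrite -powRM ?(ltW s0)//; last first.
    by rewrite addr_ge0// !mulr_ge0 ?invr_ge0 ?(ltW a0, ltW b0, ltW s0).
  rewrite ge0_ler_powR ?nnegrE ?(ltW p0)//.
    rewrite mulr_ge0 ?(ltW s0)// addr_ge0// !mulr_ge0 ?invr_ge0//;
    by rewrite ?(ltW a0, ltW b0, ltW s0).
  apply: (le_trans (ler_normD _ _)).
  by rewrite le_eqVlt; apply/predU1P; left; field; lra.
rewrite -big_distrr/= big_split/= -!big_distrr/= -!big_distrl/= -uE -vE.
rewrite !mulfV ?gt_eqF ?powR_gt0// !mulr1 -mulrDl mulfV ?gt_eqF//.
by rewrite mulr1.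
Qed.

(** Each coordinate is at most the l_2 norm N, so |v_i|^p = |v_i|^2 |v_i|^(p-2) <= |v_i|^2
    N^(p-2). *)
Lemma lpnorm_le2 (R : realType) (n : nat) (p : \bar R) (v : 'rV[R]_n) :
  (2%:E <= p)%E -> lpnorm p v <= lpnorm 2%:E v.
Proof.
move=> p2; set N := lpnorm 2%:E v.
have N0 : 0 <= N := lpnorm_ge0 _ _.
have N2 : N `^ 2 = \sum_i `|v 0 i| `^ 2 by exact: powR_lpnorm.
have vN i : `|v 0 i| <= N.
  rewrite leNgt; apply/negP => Nv.
  have := @gt0_ltr_powR R 2 (ltr0n _ 2) N `|v 0 i|.
  rewrite !nnegrE N0 normr_ge0 => /(_ isT isT Nv).
  rewrite N2 (bigD1 i)//= ltNge lerDl sumr_ge0// => j _; exact: powR_ge0.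
case: p p2 => [p|_|//]; last first.
  exact: bigmax_le.
rewrite lee_fin => p2; have p0 : 0 < p by lra.
apply: lpnorm_le => //.
have [N0'|Nn0] := eqVneq N 0.
  rewrite N0' powR0 ?gt_eqF// big1// => i _.
  have := vN i; rewrite N0' normr_le0 => /eqP ->.
  by rewrite normr0 powR0 ?gt_eqF.
have pE x : 0 <= x -> x `^ p = x `^ 2 * x `^ (p - 2).
  rewrite le_eqVlt => /predU1P[<-|x0].
    by rewrite powR0 ?gt_eqF// [X in X * _]powR0 ?mul0r// pnatr_eq0.
  rewrite -powRD; last by rewrite (gt_eqF x0) implybT.
  by congr powR; ring.
rewrite pE// N2 big_distrl/=; apply: ler_sum => i _.
rewrite pE// ler_wpM2l ?powR_ge0//.
by rewrite ge0_ler_powR ?nnegrE// subr_ge0.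
Qed.

(** * Moments of the counts *)

Lemma esp_count (R : realType) (n : nat) (A : 'rV[R]_n) (m : nat) (i : 'I_n) :
  distribution_on A -> esp A m (fun l => (count_mem i l)%:R) = m%:R * A 0 i.
Proof.
move=> dA; elim: m => [|m IH] /=; first by rewrite mul0r.
have step j : esp A m (fun l => (count_mem i (j :: l))%:R) =
    (j == i)%:R + m%:R * A 0 i.
  rewrite -IH -[X in _ = X + _](esp_cst m _ dA) -espD.
  by apply: eq_esp => l; rewrite -natrD.
under eq_bigr do rewrite step mulrDr.
rewrite big_split/= -big_distrl/= (proj2 dA) mul1r -natr1 mulrDl mul1r addrC.
congr (_ + _); rewrite (bigD1 i)//= eqxx mulr1 big1 ?addr0// => j /negPf ->.
by rewrite mulr0.
Qed.

(** The centre [x] is arbitrary so that the induction closes: the first draw shifts it by 0 or 1. *)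
Lemma esp_sqr_count (R : realType) (n : nat) (A : 'rV[R]_n) (m : nat)
    (i : 'I_n) (x : R) :
  distribution_on A ->
  esp A m (fun l => ((count_mem i l)%:R - x) ^+ 2) =
  m%:R * A 0 i * (1 - A 0 i) + (m%:R * A 0 i - x) ^+ 2.
Proof.
move=> dA; elim: m x => [|m IH] x /=; first by rewrite !mul0r !add0r.
have step j : esp A m (fun l => ((count_mem i (j :: l))%:R - x) ^+ 2) =
    m%:R * A 0 i * (1 - A 0 i) + (m%:R * A 0 i - (x - (j == i)%:R)) ^+ 2.
  rewrite -IH; apply: eq_esp => l; congr (_ ^+ 2).
  by rewrite /= natrD; ring.
under eq_bigr do rewrite step.
have A1 : A 0 i + \sum_(j < n | j != i) A 0 j = 1.
  by rewrite -(proj2 dA) [in RHS](bigD1 i).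
rewrite (bigD1 i)//= eqxx.
under eq_bigr => j /negPf -> do rewrite subr0.
rewrite -big_distrl/= (_ : \sum_(j < n | _) _ = 1 - A 0 i); last first.
  by rewrite -A1; ring.
by rewrite -natr1; ring.
Qed.

Lemma esp_sqr_deviation (R : realType) (n : nat) (A : 'rV[R]_n) (m : nat)
    (i : 'I_n) :
  distribution_on A ->
  esp A m (fun l => ((count_mem i l)%:R - m%:R * A 0 i) ^+ 2) <= m%:R * A 0 i.
Proof.
move=> dA; rewrite esp_sqr_count// subrr expr0n addr0.
rewrite -[leRHS]mulr1 ler_wpM2l ?mulr_ge0 ?(proj1 dA)//.
by rewrite gerBl (proj1 dA).
Qed.

Lemma esp_abs_deviation (R : realType) (n : nat) (A : 'rV[R]_n) (m : nat)
    (i : 'I_n) :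
  distribution_on A ->
  esp A m (fun l => `|(count_mem i l)%:R - m%:R * A 0 i|) <=
  2 * (m%:R * A 0 i).
Proof.
move=> dA; have a0 : 0 <= m%:R * A 0 i by rewrite mulr_ge0 ?(proj1 dA).
rewrite mulrDl mul1r -[X in _ <= X + _]esp_count//.
rewrite -[X in _ <= _ + X](esp_cst m _ dA) -espD.
apply: le_esp => // l; apply: (le_trans (ler_normB _ _)).
by rewrite ger0_norm// ger0_norm.
Qed.

(** * The error vector: bounded differences and mean l_p norm *)

(** The divisor [m] is independent of the length of [l], since bounded differences range over lists
    of every length. *)
Definition deviation (R : realType) (n : nat) (A : 'rV[R]_n) (m : nat)
    (l : seq 'I_n) : 'rV[R]_n :=
  \row_i ((count_mem i l)%:R / m%:R) - A.

Lemma bounded_differences_deviation (R : realType) (n : nat) (A : 'rV[R]_n)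
    (m : nat) (p : R) :
  1 <= p -> (0 < m)%N ->
  bounded_differences (2 `^ p^-1 / m%:R)
    (fun l => lpnorm p%:E (deviation A m l)).
Proof.
move=> p1 m0 l1 l2 i j; have p0 : 0 < p by rewrite (lt_le_trans ltr01).
have m0R : 0 < m%:R :> R by rewrite ltr0n.
pose D : 'rV[R]_n := \row_k (((i == k)%:R - (j == k)%:R) / m%:R).
have -> : deviation A m (l1 ++ i :: l2) = D + deviation A m (l1 ++ j :: l2).
  apply/rowP => k; rewrite !mxE !count_cat/= !natrD; field.
  by rewrite gt_eqF.
rewrite lerBlDr; apply: (le_trans (lpnorm_triangle _ _ p1)).
rewrite lerD2r; apply: lpnorm_le => //.
rewrite powRM ?powR_ge0 ?invr_ge0 ?(ltW m0R)// -powRrM mulVf ?gt_eqF//.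
rewrite powRr1//.
(* Coordinatewise |[i=k] - [j=k]|^p <= [i=k] + [j=k], and the right side sums to 2; when i = j the
   left side vanishes. *)
apply: (@le_trans _ _
    (\sum_k ((i == k)%:R + (j == k)%:R) * (m%:R^-1 `^ p))).
  apply: ler_sum => k _; rewrite mxE normrM normfV (ger0_norm (ltW m0R)).
  rewrite powRM ?invr_ge0 ?(ltW m0R)// ler_wpM2r ?powR_ge0//.
  case: (i == k); case: (j == k);
    by rewrite ?(subrr, subr0, sub0r, normrN, normr0, normr1, powR1) ?powR0
      ?gt_eqF// ?addr0 ?add0r// ler0n.
have d1 (x : 'I_n) : \sum_k (x == k)%:R = 1 :> R.
  rewrite (bigD1 x)//= eqxx big1 ?addr0// => k.
  by rewrite eq_sym => /negPf ->.
by rewrite -big_distrl/= big_split/= !d1.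
Qed.

(** Jensen for y^(1/p), through its tangent line at y = b^p: the mean of that line is at most [b] by
    hypothesis. *)
Lemma esp_lpnorm_le (R : realType) (n : nat) (A : 'rV[R]_n) (m : nat)
    (p b : R) (V : seq 'I_n -> 'rV[R]_n) :
  distribution_on A -> 1 <= p -> 0 < b ->
  \sum_i esp A m (fun l => `|V l 0 i| `^ p) <= b `^ p ->
  esp A m (fun l => lpnorm p%:E (V l)) <= b.
Proof.
move=> dA p1 b0 Vb; have p0 : 0 < p by rewrite (lt_le_trans ltr01).
have bp0 : 0 < b `^ p by rewrite powR_gt0.
have pV1 : 0 <= p^-1 <= 1 by rewrite invr_ge0 ltW//= invf_le1.
apply: (@le_trans _ _ (esp A m (fun l => b * (1 - p^-1) +
    (b * p^-1 / b `^ p) * \sum_i `|V l 0 i| `^ p))).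
  apply: le_esp => // l; rewrite -powR_lpnorm//.
  have x0 : 0 <= lpnorm p%:E (V l) := lpnorm_ge0 _ _.
  move: (lpnorm _ _) x0 => x x0.
  have y0 : 0 <= x `^ p / b `^ p by rewrite divr_ge0 ?powR_ge0.
  have := powR_le_affine y0 pV1.
  rewrite powRM ?powR_ge0 ?invr_ge0 ?(ltW bp0)// -powRN -!powRrM.
  rewrite mulNr mulfV ?gt_eqF// powRr1// powR_inv1 ?(ltW b0)//.
  move=> /(ler_wpM2l (ltW b0)); rewrite [b * (x / b)]mulrC divfK ?gt_eqF//.
  move=> /le_trans; apply; rewrite le_eqVlt; apply/predU1P; left.
  by rewrite powRN; ring.
rewrite espD esp_cst// espZ esp_sum.
have b1 : 0 <= b * p^-1 / b `^ p by rewrite !mulr_ge0 ?invr_ge0 ?(ltW b0) ?ltW.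
apply: (le_trans (lerD (lexx _) (ler_wpM2l b1 Vb))).
by rewrite divfK ?gt_eqF// -mulrDr subrK mulr1.
Qed.

Lemma sum_esp_deviation_le_dim (R : realType) (n : nat) (A : 'rV[R]_n) (m : nat)
    (p : R) :
  distribution_on A -> 1 <= p <= 2 -> (0 < m)%N -> (0 < n)%N ->
  \sum_i esp A m (fun l => `|deviation A m l 0 i| `^ p) <=
  (m%:R * n%:R)^-1 `^ (p / 2) * n%:R.
Proof.
move=> dA /andP[p1 p2] m0 n0.
have m0R : 0 < m%:R :> R by rewrite ltr0n.
have n0R : 0 < n%:R :> R by rewrite ltr0n.
have mn0R : 0 < m%:R * n%:R :> R by rewrite mulr_gt0.
have p01 : 0 <= p / 2 <= 1 by apply/andP; split; lra.
(* The variance bound A_i / m averages to [s] over the coordinates; the tangent to y^(p/2) is taken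
   at y = s. *)
set s := (_ * _)^-1; have s0 : 0 < s by rewrite invr_gt0.
apply: (@le_trans _ _ (\sum_i (s `^ (p / 2) * (1 - p / 2) +
    s `^ (p / 2) * (p / 2) * n%:R * A 0 i))).
  apply: ler_sum => i _.
  apply: (@le_trans _ _ (esp A m (fun l => s `^ (p / 2) * (1 - p / 2) +
      (s `^ (p / 2) * (p / 2) * n%:R / m%:R) *
      ((count_mem i l)%:R - m%:R * A 0 i) ^+ 2))).
    apply: le_esp => // l; rewrite !mxE.
    set c : R := (count_mem i l)%:R.
    have y0 : 0 <= (c / m%:R - A 0 i) ^+ 2 / s by rewrite divr_ge0 ?sqr_ge0 ?ltW.
    have := powR_le_affine y0 p01.
    rewrite powRM ?sqr_ge0 ?invr_ge0 ?(ltW s0)//.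
    rewrite -[s^-1]powR_inv1 ?(ltW s0)// -powRrM mulN1r powRN.
    rewrite -real_normK ?num_real// -powR_mulrn// -powRrM.
    rewrite [2%:R * _]mulrC divfK ?pnatr_eq0//.
    rewrite ler_pdivrMr ?powR_gt0// => /le_trans; apply.
    rewrite powR_mulrn// real_normK ?num_real// powR_inv1 ?(ltW s0)//.
    rewrite /s invrK le_eqVlt; apply/predU1P; left.
    by field; rewrite gt_eqF.
  rewrite espD esp_cst// espZ lerD2l.
  apply: (le_trans (ler_wpM2l _ (esp_sqr_deviation m i dA))).
    by rewrite !mulr_ge0 ?powR_ge0 ?invr_ge0//; lra.
  by rewrite le_eqVlt; apply/predU1P; left; field; rewrite gt_eqF.
rewrite big_split/= sumr_const card_ord -[X in X + _]mulr_natr.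
rewrite -big_distrr/= (proj2 dA).
by rewrite le_eqVlt; apply/predU1P; left; field.
Qed.

(** Writing z^p = z z^(p-1) bounds the p-th moment by the first two, whose bounds are both linear in
    A_i; summing over i therefore leaves no factor n. *)
Lemma sum_esp_deviation_le_dimfree (R : realType) (n : nat) (A : 'rV[R]_n)
    (m : nat) (p : R) :
  distribution_on A -> 1 <= p <= 2 -> (0 < m)%N ->
  \sum_i esp A m (fun l => `|deviation A m l 0 i| `^ p) <=
  m%:R `^ (1 - p) * 2 `^ (2 - p).
Proof.
move=> dA /andP[p1 p2] m0.
have m0R : 0 < m%:R :> R by rewrite ltr0n.
have p01 : 0 <= p - 1 <= 1 by apply/andP; split; lra.
pose c : R := (m%:R `^ (- p)) * 2 `^ (1 - p).
have c0 : 0 <= c by rewrite mulr_ge0 ?powR_ge0.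
have cE : m%:R `^ (1 - p) * 2 `^ (2 - p) = c * (2 * m%:R).
  have powRS (x r : R) : 0 < x -> x `^ (r + 1) = x `^ r * x.
    by move=> x0; rewrite powRD ?powRr1 ?ltW// (gt_eqF x0) implybT.
  rewrite [1 - p](_ : _ = - p + 1); last by ring.
  rewrite [2 - p](_ : _ = (1 - p) + 1); last by ring.
  by rewrite !powRS// /c; ring.
apply: (@le_trans _ _ (\sum_i c * (2 * m%:R) * A 0 i)); last first.
  by rewrite -big_distrr/= (proj2 dA) mulr1 cE.
apply: ler_sum => i _.
apply: (@le_trans _ _ (esp A m (fun l =>
    c * (2 - p) * `|(count_mem i l)%:R - m%:R * A 0 i| +
    c * (2 * (p - 1)) * ((count_mem i l)%:R - m%:R * A 0 i) ^+ 2))).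
  (* weighted AM-GM for [z ^ (p - 1)], at scale [1 / 2]: the value that balances
     the bounds [2 m a] and [m a] on the two moments *)
  apply: le_esp => // l; rewrite !mxE.
  set k : R := (count_mem i l)%:R.
  rewrite [k / _ - _](_ : _ = (k - m%:R * A 0 i) / m%:R); last first.
    by field; rewrite gt_eqF.
  rewrite normrM normfV (ger0_norm (ltW m0R)) powRM ?invr_ge0 ?(ltW m0R)//.
  rewrite -[m%:R^-1]powR_inv1 ?(ltW m0R)// -powRrM mulN1r mulrC.
  rewrite -real_normK ?num_real//.
  move: `|_| (normr_ge0 (k - m%:R * A 0 i)) => z z0.
  rewrite /c -!mulrA -mulrDr ler_wpM2l ?powR_ge0//.
  have y0 : 0 <= 2 * z by rewrite mulr_ge0.
  rewrite -mulr_powRB1//; last by lra.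
  have := powR_le_affine y0 p01; rewrite powRM//.
  rewrite -[1 - p]opprB powRN -ler_pdivlMl ?powR_gt0// => /(ler_wpM2l z0).
  move=> /le_trans; apply.
  by rewrite le_eqVlt; apply/predU1P; left; ring.
rewrite espD !espZ.
have b1 : 0 <= c * (2 - p) by rewrite mulr_ge0//; lra.
have b2 : 0 <= c * (2 * (p - 1)) by rewrite mulr_ge0//; lra.
(* The coefficients add up to 2 (2 - p) + 2 (p - 1) = 2, whatever p is. *)
apply: (le_trans (lerD (ler_wpM2l b1 (esp_abs_deviation m i dA))
  (ler_wpM2l b2 (esp_sqr_deviation m i dA)))).
by rewrite le_eqVlt; apply/predU1P; left; ring.
Qed.

Lemma esp_half_le_learn (R : realType) (n : nat) (A : 'rV[R]_n) (m : nat)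
    (p eps delta : R) :
  distribution_on A -> 1 <= p -> 0 < eps -> 0 < delta -> (0 < m)%N ->
  2 `^ (2 / p + 1) * ln (1 / delta) / eps ^+ 2 <= m%:R ->
  esp A m (fun l => lpnorm p%:E (deviation A m l)) <= eps / 2 ->
  1 - delta <=
  esp A m (fun l => (lpnorm p%:E (deviation A m l) <= eps)%R%:R).
Proof.
move=> dA p1 e0 d0 m0 mb Eb.
have m0R : 0 < m%:R :> R by rewrite ltr0n.
set K : R := 2 `^ (2 / p); have K0 : 0 < K by rewrite powR_gt0.
have KE : (2 `^ p^-1) ^+ 2 = K.
  by rewrite -powR_mulrn ?powR_ge0// -powRrM mulrC.
have K2 : 2 `^ (2 / p + 1) = 2 * K.
  by rewrite powRD ?pnatr_eq0 ?implybT// powRr1// mulrC.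
(* Here c^2 = K / m^2, and this [s] minimises the exponent - s eps / 2 + s^2 K / (8 m), with minimum
   - m eps^2 / (2 K). *)
have s0 : 0 <= 2 * eps * m%:R / K by rewrite !mulr_ge0 ?invr_ge0 ?ltW.
apply: le_trans (mcdiarmid _ _ dA s0 (bounded_differences_deviation A p1 m0)).
rewrite lerB// -[leRHS]lnK ?posrE// ler_expR.
rewrite [(_ / m%:R) ^+ 2]exprMn KE exprVn.
have {}mb : 2 * K * ln (1 / delta) <= m%:R * eps ^+ 2.
  by rewrite -ler_pdivrMr ?exprn_gt0// -K2.
rewrite div1r lnV ?posrE// in mb.
set E := esp _ _ _ in Eb *.
apply: (@le_trans _ _ (2 * eps * m%:R / K * (eps / 2 - eps) +
    m%:R * ((2 * eps * m%:R / K) ^+ 2 * (K / m%:R ^+ 2) / 8))).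
  by rewrite lerD2r ler_wpM2l// lerB.
rewrite [leLHS](_ : _ = - (m%:R * eps ^+ 2) / (2 * K)); last first.
  by field; rewrite !gt_eqF.
by rewrite ler_pdivrMr ?mulr_gt0//; lra.
Qed.

(** * From finite sums to the probability space *)

(** The event is a finite disjoint union of fibres of the sample vector, and independence over the
    full index set gives each fibre its product weight. *)
Lemma prob_samples (R : realType) (n : nat) (A : 'rV[R]_n)
    (d : measure_display) (T : measurableType d) (P : probability T R)
    (m : nat) (S : 'I_m -> T -> 'I_n) (Q : pred (seq 'I_n)) :
  iid_samples P A S ->
  P [set w | Q [tuple S j w | j < m]] = (esp A m (fun l => (Q l)%:R))%:E.
Proof.
move=> [mS lawS indS].
pose F (t : m.-tuple 'I_n) : set T :=
  \bigcap_(j in [set` [set: 'I_m]%SET]) S j @^-1` [set tnth t j].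
have FE t w : F t w <-> [tuple S j w | j < m] = t.
  split=> [Ftw|<- j _]; last by rewrite /= tnth_mktuple.
  by apply: eq_from_tnth => j; rewrite tnth_mktuple; apply: Ftw; rewrite /= inE.
have mF t : measurable (F t).
  by apply: fin_bigcap_measurable => // j _; exact: mS.
have PF t : P (F t) = (\prod_(j < m) A 0 (tnth t j))%:E.
  rewrite indS -prodEFin; apply: eq_big => [j|j _]; first by rewrite inE.
  exact: lawS.
rewrite [X in P X](_ : _ = \bigcup_(t in [set t : m.-tuple 'I_n | Q t]) F t).
  have trivF : trivIset [set t : m.-tuple 'I_n | Q t] F.
    by move=> t u _ _ [w [/FE <- /FE <-]].
  rewrite (measure_fin_bigcup _ finite_finset trivF)//.
  rewrite -(bigfs (P := [pred t : m.-tuple 'I_n | Q t])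
    _ (index_enum_uniq _))//=; last first.
    by move=> t _; rewrite mem_index_enum.
  rewrite esp_tupleE -sumEFin big_mkcond; apply: eq_bigr => t _; rewrite PF/=.
  by case: (Q t); rewrite ?mulr1 ?mulr0.
apply/seteqP; split=> [w Qw|w [t Qt /FE wt]]; last by rewrite -wt in Qt.
by exists [tuple S j w | j < m] => //; apply/FE.
Qed.

Lemma empirical_deviation (R : realType) (n : nat) (A : 'rV[R]_n) (T : Type)
    (m : nat) (S : 'I_m -> T -> 'I_n) (w : T) :
  empirical R S w - A = deviation A m [tuple S j w | j < m].
Proof.
congr (_ - A); apply/rowP => i; rewrite !mxE; congr (_%:R / _).
rewrite /sample_count cardE size_filter -enumT/= count_map.
by apply: eq_count => j; rewrite /= finset.in_set.
Qed.

Lemma prob_lpnorm_empirical (R : realType) (n : nat) (A : 'rV[R]_n)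
    (d : measure_display) (T : measurableType d) (P : probability T R)
    (m : nat) (S : 'I_m -> T -> 'I_n) (p : \bar R) (eps : R) :
  iid_samples P A S ->
  P [set w | (lpnorm p (empirical R S w - A) <= eps)%R] =
  (esp A m (fun l => (lpnorm p (deviation A m l) <= eps)%R%:R))%:E.
Proof.
move=> hS.
rewrite -(prob_samples (fun l => lpnorm p (deviation A m l) <= eps) hS).
by congr (P _); apply/seteqP; split=> w /=; rewrite empirical_deviation.
Qed.

(** * Sufficient sample sizes *)

Lemma learn_of_deviation (R : realType) (n : nat) (eps delta : R)
    (A : 'rV[R]_n) (d : measure_display) (T : measurableType d)
    (P : probability T R) (m : nat) (S : 'I_m -> T -> 'I_n) (p : R) :
  0 < eps -> 0 < delta -> (0 < m)%N -> distribution_on A -> iid_samples P A S ->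
  1 <= p ->
  2 `^ (2 / p + 1) * ln (1 / delta) / eps ^+ 2 <= m%:R ->
  \sum_i esp A m (fun l => `|deviation A m l 0 i| `^ p) <= (eps / 2) `^ p ->
  ((1 - delta)%:E <=
    P [set w | (lpnorm p%:E (empirical R S w - A) <= eps)%R])%E.
Proof.
move=> e0 d0 m0 dA hS p1 mb Vb.
rewrite prob_lpnorm_empirical// lee_fin; apply: esp_half_le_learn => //.
by apply: esp_lpnorm_le => //; rewrite divr_gt0.
Qed.

(** The exponent 1 - 1/p stands for 1/q, also at p = 1, where it is 0; the instance p = 2 later
    serves all p >= 2. *)
Lemma learn_dim (R : realType) (n : nat) (eps delta : R)
    (A : 'rV[R]_n) (d : measure_display) (T : measurableType d)
    (P : probability T R) (m : nat) (S : 'I_m -> T -> 'I_n) (p : R) :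
  (0 < n)%N -> 0 < eps -> 0 < delta -> (0 < m)%N ->
  distribution_on A -> iid_samples P A S ->
  1 <= p <= 2 ->
  2 `^ (2 / p + 1) * ln (1 / delta) / eps ^+ 2 <= m%:R ->
  4 * (n%:R / (n%:R `^ (1 - p^-1) * eps) ^+ 2) <= m%:R ->
  ((1 - delta)%:E <=
    P [set w | (lpnorm p%:E (empirical R S w - A) <= eps)%R])%E.
Proof.
move=> n0 e0 d0 m0 dA hS /andP[p1 p2] mb M.
have p0 : 0 < p by lra.
have m0R : 0 < m%:R :> R by rewrite ltr0n.
have n0R : 0 < n%:R :> R by rewrite ltr0n.
apply: learn_of_deviation => //.
have p12 : 1 <= p <= 2 by rewrite p1.
apply: (le_trans (sum_esp_deviation_le_dim dA p12 m0 n0)).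
set r : R := n%:R `^ p^-1.
have r0 : 0 < r by rewrite powR_gt0.
(* Writing both sides as powers p/2 reduces the goal to the bases: n^(2/p) / (m n) <= (eps/2)^2. *)
have nE : n%:R = (r ^+ 2) `^ (p / 2).
  rewrite -powR_mulrn ?ltW// -!powRrM [X in _ `^ X](_ : _ = 1) ?powRr1 ?ltW//.
  by field; rewrite gt_eqF.
have rE : n%:R `^ (1 - p^-1) = n%:R / r.
  by rewrite powRB ?powRr1 ?ltW// (gt_eqF n0R) implybT.
have eE : (eps / 2) `^ p = ((eps / 2) ^+ 2) `^ (p / 2).
  by rewrite -powR_mulrn ?divr_ge0 ?ltW// -powRrM [2%:R * _]mulrC divfK ?pnatr_eq0.
rewrite [in X in _ * X]nE eE -powRM ?invr_ge0 ?exprn_ge0 ?(ltW r0)//.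
rewrite ge0_ler_powR ?nnegrE ?divr_ge0 ?mulr_ge0 ?invr_ge0 ?exprn_ge0//;
  rewrite ?divr_ge0 ?mulr_ge0 ?(ltW p0, ltW e0, ltW r0, ltW m0R)//.
rewrite mulrC ler_pdivrMr ?mulr_gt0//.
move: M; rewrite rE.
rewrite [X in X <= _ -> _](_ : _ = r ^+ 2 / (n%:R * (eps / 2) ^+ 2)); last first.
  by field; rewrite !gt_eqF.
rewrite ler_pdivrMr ?mulr_gt0 ?exprn_gt0 ?divr_gt0//.
by move=> /le_trans; apply; rewrite le_eqVlt; apply/predU1P; left; ring.
Qed.

Lemma learn_dimfree (R : realType) (n : nat) (eps delta : R)
    (A : 'rV[R]_n) (d : measure_display) (T : measurableType d)
    (P : probability T R) (m : nat) (S : 'I_m -> T -> 'I_n) (p : R) :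
  0 < eps -> 0 < delta -> (0 < m)%N ->
  distribution_on A -> iid_samples P A S ->
  1 < p <= 2 ->
  2 `^ (2 / p + 1) * ln (1 / delta) / eps ^+ 2 <= m%:R ->
  1 / 4 * (4 / eps) `^ (p / (p - 1)) <= m%:R ->
  ((1 - delta)%:E <=
    P [set w | (lpnorm p%:E (empirical R S w - A) <= eps)%R])%E.
Proof.
move=> e0 d0 m0 dA hS /andP[p1 p2] mb M.
have p0 : 0 < p by lra.
have q0 : 0 < p - 1 by lra.
have m0R : 0 < m%:R :> R by rewrite ltr0n.
apply: learn_of_deviation => //; first exact: ltW.
have p12 : 1 <= p <= 2 by rewrite p2 ltW.
apply: (le_trans (sum_esp_deviation_le_dimfree dA p12 m0)).
(* Raising to the power p - 1 turns the exponent q = p / (p - 1) into p. *)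
have {}M : (4 / eps) `^ p <= 4 `^ (p - 1) * m%:R `^ (p - 1).
  have {}M : (4 / eps) `^ (p / (p - 1)) <= 4 * m%:R by lra.
  have := ge0_ler_powR (ltW q0) _ _ M.
  rewrite !nnegrE powR_ge0 mulr_ge0// => /(_ isT isT).
  by rewrite -powRrM divfK ?gt_eqF// [leRHS]powRM.
rewrite -[1 - p]opprB powRN mulrC ler_pdivrMr ?powR_gt0//.
move: M; rewrite !powRM ?invr_ge0 ?(ltW e0)//.
rewrite -[eps^-1]powR_inv1 ?(ltW e0)// -powRrM mulN1r powRN.
rewrite -[2^-1]powR_inv1// -powRrM mulN1r.
rewrite ler_pdivrMr ?powR_gt0// => M.
(* This factor converts the hypothesis exactly into the goal, as 4^(-p) 4^(p-1) 2^(2-p) = 2^(-p). *)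
have f0 : 0 < (4 : R) `^ (- p) * 2 `^ (2 - p) by rewrite mulr_gt0 ?powR_gt0.
have := ler_wpM2l (ltW f0) M.
have fE : (4 : R) `^ (- p) * 4 `^ p = 1 by rewrite powRN mulVf// gt_eqF// powR_gt0.
have gE : (4 : R) `^ (- p) * 4 `^ (p - 1) * 2 `^ (2 - p) = 2 `^ (- p).
  rewrite -powRD ?pnatr_eq0 ?implybT// [- p + _](_ : _ = -1); last by ring.
  rewrite (_ : 4 = 2 `^ 2); last by rewrite powR_mulrn// -natrX.
  rewrite -powRrM -powRD ?pnatr_eq0 ?implybT//; congr powR; ring.
have -> : 4 `^ (- p) * 2 `^ (2 - p) * 4 `^ p = (2 : R) `^ (2 - p).
  by rewrite mulrAC fE mul1r.
move=> /le_trans; apply.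
by rewrite -gE le_eqVlt; apply/predU1P; left; ring.
Qed.

Lemma sample_bound_M_case (R : realType) (n : nat) (eps p x : R) :
  1 <= p -> sample_bound_M n eps (hoelder_conjugate p%:E) <= x ->
  4 * (n%:R / (n%:R `^ (1 - p^-1) * eps) ^+ 2) <= x \/
  1 < p /\ 1 / 4 * (4 / eps) `^ (p / (p - 1)) <= x.
Proof.
(* At p = 1 the conjugate is +oo: the first branch is taken, and n^(1/q) has exponent 0. *)
rewrite le_eqVlt => /predU1P[<-|p1].
  rewrite hoelder_conjugate1 /sample_bound_M /root_ext/= leey.
  by rewrite invr1 subrr; left.
have qE : hoelder_conjugate p%:E = (p / (p - 1))%:E.
  rewrite /hoelder_conjugate/= eqe gt_eqF ?(lt_trans ltr01)//.
  by rewrite -EFinB inver subr_eq0 gt_eqF.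
have q0 : p / (p - 1) != 0.
  by rewrite gt_eqF// divr_gt0 ?subr_gt0// (lt_trans ltr01).
rewrite /sample_bound_M qE /root_ext/= inver (negPf q0)/=.
rewrite (_ : (p / (p - 1))^-1 = 1 - p^-1); last by field; lra.
by case: ifPn => _; [left|right].
Qed.

(** * Assembly: p <= 2, the special case p = 1, and p >= 2 *)

Unset Implicit Arguments.

Theorem theorem9 (R : realType) (n : nat) (eps delta : R) (A : 'rV[R]_n)
    (hn : (2 <= n)%N) (heps : 0 < eps < 1) (hdelta : 0 < delta < 1)
    (hA : distribution_on A)
    (d : measure_display) (T : measurableType d) (P : probability T R)
    (m : nat) (S : 'I_m -> T -> 'I_n) (hS : iid_samples P A S) :
  [/\ (forall p : R, 1 <= p <= 2 ->
        Num.max (2 `^ (2 / p + 1) * ln (1 / delta) / eps ^+ 2)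
                (sample_bound_M n eps (hoelder_conjugate p%:E)) <= m%:R ->
        ((1 - delta)%:E <=
          P [set w | (lpnorm p%:E (empirical R S w - A) <= eps)%R])%E),
      (Num.max (8 * ln (1 / delta) / eps ^+ 2) (4 * n%:R / eps ^+ 2) <= m%:R ->
        ((1 - delta)%:E <=
          P [set w | (lpnorm 1%:E (empirical R S w - A) <= eps)%R])%E)
    & (forall p : \bar R, (2%:E <= p)%E ->
        Num.max (4 * ln (1 / delta) / eps ^+ 2) (4 / eps ^+ 2) <= m%:R ->
        ((1 - delta)%:E <=
          P [set w | (lpnorm p (empirical R S w - A) <= eps)%R])%E)].
Proof.
have /andP[e0 _] := heps; have /andP[d0 d1] := hdelta.
have n0 : (0 < n)%N by exact: leq_trans hn.
have m_gt0 (x : R) : 0 < x -> x <= m%:R -> (0 < m)%N.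
  by move=> x0 xm; rewrite -(ltr0n R) (lt_le_trans x0).
(* Strict positivity, from delta < 1, forces m > 0, so the empirical frequencies never divide by
   zero. *)
have L0 : 0 < ln (1 / delta) by rewrite ln_gt0// div1r invf_gt1.
have pos (p : R) : 0 < 2 `^ (2 / p + 1) * ln (1 / delta) / eps ^+ 2.
  by rewrite divr_gt0 ?exprn_gt0// mulr_gt0// powR_gt0.
have part1 (p : R) : 1 <= p <= 2 ->
    Num.max (2 `^ (2 / p + 1) * ln (1 / delta) / eps ^+ 2)
            (sample_bound_M n eps (hoelder_conjugate p%:E)) <= m%:R ->
    ((1 - delta)%:E <=
      P [set w | (lpnorm p%:E (empirical R S w - A) <= eps)%R])%E.
  move=> p12; have /andP[p1 p2] := p12; rewrite ge_max => /andP[mb M].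
  have m0 := m_gt0 _ (pos p) mb.
  have [{}M|[p1' {}M]] := sample_bound_M_case p1 M.
    exact: (learn_dim n0 e0 d0 m0 hA hS p12).
  by apply: (learn_dimfree e0 d0 m0 hA hS) => //; rewrite p1'.
have two3 : (2 : R) `^ (2 / 1 + 1) = 8.
  by rewrite divr1 -(natrD _ 2 1) powR_mulrn// -natrX.
have two2 : (2 : R) `^ (2 / 2 + 1) = 4.
  by rewrite divff ?pnatr_eq0// -(natrD _ 1 1) powR_mulrn// -natrX.
split=> //.
- rewrite ge_max => /andP[mb M]; rewrite -two3 in mb.
  have m0 := m_gt0 _ (pos 1) mb.
  apply: (learn_dim n0 e0 d0 m0 hA hS) => //; first by rewrite lexx ler1n.
  by rewrite invr1 subrr powRr0 mul1r mulrA.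
- move=> p p2; rewrite ge_max => /andP[mb M]; rewrite -two2 in mb.
  have m0 := m_gt0 _ (pos 2) mb.
  have := @learn_dim R n eps delta A d T P m S 2 n0 e0 d0 m0 hA hS _ mb.
  rewrite ler1n lexx => /(_ isT).
  have n0R : 0 < n%:R :> R by rewrite ltr0n.
  (* At p = 2 the squared root (n^(1/2))^2 cancels n, which removes the dimension. *)
  have -> : 4 * (n%:R / (n%:R `^ (1 - 2^-1) * eps) ^+ 2) = 4 / eps ^+ 2.
    rewrite exprMn -[(_ `^ _) ^+ 2]powR_mulrn ?powR_ge0// -powRrM.
    rewrite (_ : (1 - 2^-1) * 2 = 1); last by field.
    rewrite powRr1 ?ltW//; field.
    by rewrite !gt_eqF.
  move=> /(_ M)/le_trans; apply.
  (* For p >= 2 the l_p event contains the l_2 event. *)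
  rewrite !prob_lpnorm_empirical// lee_fin; apply: le_esp => // l.
  rewrite ler_nat; case: leP => //= l2.
  by rewrite (le_trans (lpnorm_le2 _ p2)).
Qed.
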